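(* Let $p,q,l$ be integers with $p,q\ge 3$, $l\ge 1$, let $G=\infty(p,q,l)$ and let $\Gamma(G)=(G,\sigma)$ be any signed graph with underlying graph $G$. Let $\Gamma(C_p)$ and $\Gamma(C_q)$ denote the two signed cycles of $\Gamma(G)$ (of lengths $p$ and $q$), and $s(\Gamma(C_p))$, $s(\Gamma(C_q))$ their numbers of negative edges. (1) If $p$ and $q$ are both odd, then: $\eta(\Gamma(G))=0$ if $l$ is even; $\eta(\Gamma(G))=0$ if $l$ is odd and $s(\Gamma(C_p))-s(\Gamma(C_q))+\frac{q-p}{2}\equiv 0\pmod 2$; $\eta(\Gamma(G))=1$ if $l=1$ and $s(\Gamma(C_p))-s(\Gamma(C_q))+\frac{q-p}{2}\equiv 1\pmod 2$; $\eta(\Gamma(G))\ge 1$ if $l\ge 3$ is odd and $s(\Gamma(C_p))-s(\Gamma(C_q))+\frac{q-p}{2}\equiv 1\pmod 2$. (2) If $p$ and $q$ have different parities, say $p$ is even, then $\eta(\Gamma(G))=0$ if $\eta(\Gamma(C_p))=0$, and $\eta(\Gamma(G))=1$ if $\eta(\Gamma(C_p))=2$. (3) If $p$ and $q$ are both even, then: $\eta(\Gamma(G))=3$ if $l$ is odd and $\eta(\Gamma(C_p))=\eta(\Gamma(C_q))=2$; $\eta(\Gamma(G))=1$ if $l$ is odd and $\eta(\Gamma(C_p))\cdot\eta(\Gamma(C_q))=0$; $\eta(\Gamma(G))=2$ if $l$ is even and ($\eta(\Gamma(C_p))=2$ or $\eta(\Gamma(C_q))=2$); $\eta(\Gamma(G))=0$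 if $l$ is even and $\eta(\Gamma(C_p))=\eta(\Gamma(C_q))=0$.
   Context: A signed graph $\Gamma(G)=(G,\sigma)$ consists of a simple graph $G=(V,E)$ and a map $\sigma:E\to\{+,-\}$; its adjacency matrix has $(i,j)$ entry $\sigma(v_iv_j)$ if $v_iv_j\in E$ and $0$ otherwise, and its nullity $\eta(\cdot)$ is the multiplicity of the eigenvalue $0$ of this matrix; subgraphs inherit signs. The graph $\infty(p,q,l)$ is obtained from two vertex-disjoint cycles $C_p$ and $C_q$ by joining a vertex of $C_p$ and a vertex of $C_q$ by a path $P_l$ on $l$ vertices (of length $l-1$); when $l=1$ these two vertices are identified. Thus it has $p+q+l-2$ vertices. *)

(* Defs.v *)
From mathcomp Require Import all_boot all_order all_algebra.
From mathcomp Require Import zify.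

Set Implicit Arguments.
Unset Strict Implicit.
Unset Printing Implicit Defensive.

Import GRing.Theory Num.Theory.

(* A graph with vertices v_0, ..., v_(n-1) is its set of edges, an edge being
   the 2-element set of its end points. *)
Definition graph (n : nat) := {set {set 'I_n}}.

Definition simple_graph n (E : graph n) : Prop := forall e, e \in E -> #|e| = 2.

(* true stands for the sign -; only the values on edges are ever used, so that
   on a graph E this amounts to a map from E to {+, -}. *)
Definition signing (n : nat) := {set 'I_n} -> bool.

Definition adjacency (R : pzRingType) n (E : graph n) (sigma : signing n) :
    'M[R]_n :=
  \matrix_(i, j) (if [set i; j] \in E then (-1) ^+ sigma [set i; j] else 0)%R.

Definition nullity (R : realFieldType) n (E : graph n) (sigma : signing n) :
    nat :=
  mup 0%R (char_poly (adjacency R E sigma)).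

Definition negative_edges n (E : graph n) (sigma : signing n) : nat :=
  #|[set e in E | sigma e]|.

Definition map_graph m n (f : 'I_m -> 'I_n) (E : graph m) : graph n :=
  [set f @: e | e : {set 'I_m} in E].

(* The signs that a graph on 'I_m inherits from a graph on 'I_n in which it is
   embedded by f. *)
Definition inherit m n (f : 'I_m -> 'I_n) (sigma : signing n) : signing m :=
  fun e => sigma (f @: e).

(* ordS is the cyclic successor; this is C_n for n >= 3. *)
Definition cycle_graph (n : nat) : graph n :=
  [set [set i; ordS i] | i : 'I_n].

Definition path_graph (n : nat) : graph n :=
  [set [set x.1; x.2] | x : 'I_n * 'I_n & x.2 == x.1.+1 :> nat].

Lemma map_graph_simple m n (f : 'I_m -> 'I_n) (E : graph m) :
  injective f -> simple_graph E -> simple_graph (map_graph f E).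
Proof. by move=> f_inj sE e /imsetP[d /sE d2 ->]; rewrite card_imset. Qed.

Lemma cycle_graph_simple n : 1 < n -> simple_graph (cycle_graph n).
Proof.
move=> n_gt1 e /imsetP[i _ ->]; rewrite cards2 -val_eqE /=.
case: (ltngtP i.+1 n) (ltn_ord i) => // [lt_in | eq_in] _.
  by rewrite modn_small // neq_ltn ltnSn.
by rewrite eq_in modnn; case: (val i) eq_in n_gt1 => // <-.
Qed.

Lemma path_graph_simple n : simple_graph (path_graph n).
Proof.
move=> e /imsetP[[i j] /[!inE] /eqP /= jE ->].
by rewrite cards2 -val_eqE /= jE neq_ltn ltnSn.
Qed.

Section Infty.
Variables p q l : nat.

(* Equal to p + q + l - 2 in the range of interest (infty_orderE); the explicit
   successor is what inord needs. *)
Definition infty_order : nat := (p + q + l - 3).+1.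

(* C_p occupies the vertices 0, ..., p - 1, the path P_l the vertices
   p - 1, ..., p + l - 2 and C_q the vertices p + l - 2, ..., p + q + l - 3:
   the path shares its first vertex with C_p and its last one with C_q. *)
Definition infty_left (i : 'I_p) : 'I_infty_order := inord i.
Definition infty_mid (i : 'I_l) : 'I_infty_order := inord (p - 1 + i).
Definition infty_right (i : 'I_q) : 'I_infty_order := inord (p + l - 2 + i).

Definition infty_graph : graph infty_order :=
  map_graph infty_left (cycle_graph p) :|: map_graph infty_mid (path_graph l)
    :|: map_graph infty_right (cycle_graph q).

Hypotheses (p_ge3 : 3 <= p) (q_ge3 : 3 <= q) (l_ge1 : 1 <= l).

Lemma infty_orderE : infty_order = p + q + l - 2.
Proof. rewrite /infty_order; lia. Qed.

Lemma infty_leftE i : infty_left i = i :> nat.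
Proof. apply: inordK; have := ltn_ord i; lia. Qed.

Lemma infty_midE i : infty_mid i = p - 1 + i :> nat.
Proof. apply: inordK; have := ltn_ord i; lia. Qed.

Lemma infty_rightE i : infty_right i = p + l - 2 + i :> nat.
Proof. apply: inordK; have := ltn_ord i; lia. Qed.

Lemma infty_left_inj : injective infty_left.
Proof.
by move=> i j /(congr1 val); rewrite /= !infty_leftE => /val_inj.
Qed.

Lemma infty_mid_inj : injective infty_mid.
Proof.
by move=> i j /(congr1 val); rewrite /= !infty_midE => /addnI /val_inj.
Qed.

Lemma infty_right_inj : injective infty_right.
Proof.
by move=> i j /(congr1 val); rewrite /= !infty_rightE => /addnI /val_inj.
Qed.

Lemma infty_graph_simple : simple_graph infty_graph.
Proof.
move=> e; rewrite !in_setU => /orP[/orP[] | ] ; apply: map_graph_simple.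
- exact: infty_left_inj.
- exact: cycle_graph_simple (ltnW p_ge3).
- exact: infty_mid_inj.
- exact: path_graph_simple.
- exact: infty_right_inj.
- exact: cycle_graph_simple (ltnW q_ge3).
Qed.

End Infty.

(* Main.v *)
Require Import Defs.
From mathcomp Require Import all_boot all_order all_algebra.
From mathcomp Require Import zify ring lra.

(** The adjacency matrix A is symmetric over a real field, so ker A^2 = ker A
    and the nullity is the dimension of ker A.  The consecutive edges of the
    numbering of infty(p, q, l) form a Hamiltonian path; only the closing edges
    of the two cycles are missing from it.  Scaling rows and columns by signs
    turns the equation at an inner vertex i of this path into
    u_(i-1) = u_(i+1).  A kernel vector is therefore determined by
    (u_0, u_1, u_(n-1)), being 2-periodic on C_p, on P_l and on C_q, and the
    four equations at the ends of the closing edges leave three linear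
    conditions on this triple, which only depend on the parities of p, q and l
    and on the two signs (-1)^(s(C_p) + (p-1)/2) and (-1)^(s(C_q) + (q-1)/2)
    (up to a parity shift).  In every case the solutions are free on some of
    the three coordinates. *)

Set Implicit Arguments.
Unset Strict Implicit.
Unset Printing Implicit Defensive.

Import GRing.Theory Num.Theory.

Local Open Scope ring_scope.

(** * The nullity as the dimension of a kernel *)

(** In the basis formed by the rows of [K] and [W], [A] becomes block diagonal with blocks [0] and
    [B]. The characteristic polynomial of [B] does not vanish at 0, its constant term being [\det B]
    up to sign. *)
Lemma mup0_char_poly_block (F : fieldType) n k r (A : 'M[F]_n)
    (K : 'M_(k, n)) (W : 'M_(r, n)) (B : 'M_r) :
  (k + r)%N = n -> row_free (col_mx K W) -> K *m A = 0 -> W *m A = B *m W ->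
  B \in unitmx -> mup 0 (char_poly A) = k.
Proof.
move=> E; case: n / E in A K W *.
rewrite row_free_unit => uP KA WA uB.
set P := col_mx K W in uP.
have PA : P *m A = block_mx 0 0 0 B *m P.
  by rewrite mul_col_mx mul_block_col !mul0mx !add0r KA WA.
(* The change of basis is written as an intertwining identity over polynomials, so that only the
   determinant of [P] has to be cancelled. *)
have PcA : map_mx polyC P *m char_poly_mx A
           = char_poly_mx (block_mx 0 0 0 B) *m map_mx polyC P.
  rewrite /char_poly_mx mulmxBr mulmxBl -!map_mxM PA.
  by rewrite mul_mx_scalar mul_scalar_mx.
have detP : \det (map_mx polyC P) != 0.
  by rewrite det_map_mx polyC_eq0 -unitfE -unitmxE.
have -> : char_poly A = 'X^k * char_poly B.
  apply: (mulfI detP).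
  rewrite -det_mulmx PcA det_mulmx mulrC; congr (_ * _).
  rewrite char_block_diag_mx det_ublock; congr (_ * _).
  by rewrite /char_poly_mx map_mx0 subr0 det_scalar.
rewrite mupMl; first by rewrite -['X]subr0 -polyC0 mup_XsubCX eqxx.
rewrite rootE horner_coef0 char_poly_det mulf_neq0 ?signr_eq0 //.
by rewrite -unitfE -unitmxE.
Qed.

(** Equality of the ranks means that the kernel meets the row space trivially. The two then span
    everything, and [A] acts invertibly on its row space. *)
Lemma mup0_char_poly (F : fieldType) n (A : 'M[F]_n) :
  \rank (A *m A) = \rank A -> mup 0 (char_poly A) = \rank (kermx A).
Proof.
move=> rAA.
have AK0 : (kermx A :&: A)%MS = 0.
  apply/eqP; rewrite -mxrank_eq0 capmxC.
  by have := mxrank_mul_ker A A; rewrite rAA; lia.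
have WA : (row_base A *m A <= row_base A)%MS.
  by rewrite eq_row_base submxMl.
apply: (@mup0_char_poly_block _ _ _ _ A (row_base (kermx A)) (row_base A)
          (row_base A *m A *m pinvmx (row_base A))).
- by rewrite mxrank_ker subnK ?rank_leq_col.
- rewrite /row_free -addsmxE mxrank_disjoint_sum ?eq_row_base //.
  by apply/eqP; rewrite -mxrank_eq0 (cap_eqmx (eq_row_base _) (eq_row_base _)) AK0 mxrank0.
- by apply/eqP; rewrite -sub_kermx eq_row_base.
- by rewrite mulmxKpV.
(* The action on the row space is invertible because its product with [row_base A] has the rank of
   [A *m A], hence that of [A]. *)
- rewrite -row_free_unit /row_free eqn_leq rank_leq_row /=.
  have := mxrankM_maxl (row_base A *m A *m pinvmx (row_base A)) (row_base A).
  by rewrite mulmxKpV // (eqmxMr _ (eq_row_base A)) rAA.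
Qed.

Lemma mulmx_tr_eq0 (F : realFieldType) n (v : 'rV[F]_n) :
  v *m v^T = 0 -> v = 0.
Proof.
move=> /matrixP /(_ 0 0); rewrite !mxE => /eqP.
rewrite psumr_eq0 => [/allP v0|i _]; last by rewrite mxE -expr2 sqr_ge0.
apply/rowP => j; rewrite mxE.
by have := v0 j (mem_index_enum _); rewrite !mxE mulf_eq0 orbb => /eqP.
Qed.

Lemma mxrank_mul_sym (F : realFieldType) n (A : 'M[F]_n) :
  A^T = A -> \rank (A *m A) = \rank A.
Proof.
move=> trA.
suff : (kermx (A *m A) <= kermx A)%MS.
  move/mxrankS; rewrite !mxrank_ker leq_sub2lE ?rank_leq_row // => le_r.
  by apply/eqP; rewrite eqn_leq mxrankM_maxl.
apply/rV_subP => v; rewrite !sub_kermx => /eqP vAA.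
apply/eqP/mulmx_tr_eq0.
by rewrite trmx_mul trA mulmxA -[v *m A *m A]mulmxA vAA mul0mx.
Qed.

Lemma nullityE (F : realFieldType) n (E : graph n) (sigma : signing n) :
  nullity F E sigma = \rank (kermx (adjacency F E sigma)).
Proof.
apply/mup0_char_poly/mxrank_mul_sym.
by apply/matrixP => i j; rewrite !mxE setUC.
Qed.

(** The [E i] are independent, being dual to the coordinates [c]. They span the kernel: subtracting
    from [x] the combination weighted by its own coordinates at [c] leaves a kernel vector on which
    these coordinates vanish. *)
Lemma rank_kermx_free (F : fieldType) n k (A : 'M[F]_n)
    (c : 'I_k -> 'I_n) (E : 'I_k -> 'rV_n) :
    (forall i, E i *m A = 0) -> (forall i j, E i 0 (c j) = (i == j)%:R) ->
    (forall x : 'rV_n, x *m A = 0 -> (forall j, x 0 (c j) = 0) -> x = 0) ->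
  \rank (kermx A) = k.
Proof.
move=> EA Ec xA0.
pose M := \matrix_i E i; pose D := (colsub c 1%:M : 'M[F]_(n, k)).
have xD m (x : 'M_(m, n)) : x *m D = colsub c x by rewrite mulmx_colsub mulmx1.
have MD : M *m D = 1%:M.
  by rewrite xD; apply/matrixP => i j; rewrite !mxE Ec.
have MA : M *m A = 0.
  by apply/row_matrixP => i; rewrite row_mul rowK EA row0.
have rM : \rank M = k.
  by apply/eqP; rewrite -/(row_free M); apply/row_freeP; exists D.
rewrite -rM; apply/eqP; rewrite eqn_leq !mxrankS //; first by rewrite sub_kermx MA.
apply/rV_subP => x; rewrite sub_kermx => /eqP xA.
suff -> : x = x *m D *m M by exact: submxMl.
apply/eqP; rewrite -subr_eq0; apply/eqP/xA0.
  by rewrite mulmxBl xA -!mulmxA MA !mulmx0 subr0.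
move=> j; have /rowP/(_ j) : (x - x *m D *m M) *m D = 0.
  by rewrite mulmxBl -!mulmxA MD mulmx1 subrr.
by rewrite xD !mxE.
Qed.

Lemma rank_kermx_scale (F : fieldType) n (A : 'M[F]_n) (t t' : 'I_n -> F) :
    (forall i, t i != 0) -> (forall i, t' i != 0) ->
  \rank (kermx A) = \rank (kermx (\matrix_(i, j) (t i * A i j * t' j))).
Proof.
move=> t0 t'0; rewrite !mxrank_ker; congr (n - _)%N.
have uD (s : 'I_n -> F) : (forall i, s i != 0) -> diag_mx (\row_i s i) \in unitmx.
  move=> s0; rewrite unitmxE det_diag unitfE.
  by apply/prodf_neq0 => i _; rewrite mxE.
have -> : \matrix_(i, j) (t i * A i j * t' j)
          = diag_mx (\row_i t i) *m A *m diag_mx (\row_i t' i).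
  by apply/matrixP => i j; rewrite mul_mx_diag mul_diag_mx !mxE.
rewrite mxrankMfree ?row_free_unit ?uD //.
by rewrite -[in RHS]mxrank_tr trmx_mul mxrankMfree ?mxrank_tr // row_free_unit unitmx_tr uD.
Qed.

(** * Kernels of the rescaled matrices *)

Definition skew_path (F : pzRingType) (i j : nat) : F :=
  (i.+1 == j)%:R - (j.+1 == i)%:R.

(** Matrices act on row vectors, so column [j] is the equation at vertex [j]: [w] multiplies the
    value at [d] in the equation at [c], and [w'] the value at [c] in the equation at [d]. *)
Definition chord (F : pzRingType) (c d : nat) (w w' : F) (i j : nat) : F :=
  w * ((i == d) && (j == c))%:R + w' * ((i == c) && (j == d))%:R.

Lemma sum_delta (F : pzRingType) n (f : nat -> F) k :
  \sum_(i < n) f i * (val i == k)%:R = (k < n)%N%:R * f k.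
Proof.
case: ltnP => [ltkn|lenk].
  rewrite (bigD1 (Ordinal ltkn)) //= eqxx mulr1 mul1r big1 ?addr0 // => i.
  by rewrite -val_eqE /= => /negPf ->; rewrite mulr0.
by rewrite mul0r big1 // => i _; rewrite (ltn_eqF (leq_trans (ltn_ord i) lenk)) mulr0.
Qed.

Lemma sum_skew_path (F : comPzRingType) n (f : nat -> F) j : (j < n)%N ->
  \sum_(i < n) f i * skew_path F i j
  = (0 < j)%N%:R * f j.-1 - (j.+1 < n)%N%:R * f j.+1.
Proof.
move=> ltjn.
under eq_bigr => i _ do rewrite mulrBr [j.+1 == _]eq_sym.
rewrite sumrB sum_delta; congr (_ - _).
case: j ltjn => [|j] ltjn; first by rewrite mul0r big1 // => i _; rewrite mulr0.
under eq_bigr => i _ do rewrite eqSS.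
by rewrite sum_delta (ltnW ltjn).
Qed.

Lemma sum_chord (F : comPzRingType) n (f : nat -> F) c d w w' j :
  (c < n)%N -> (d < n)%N ->
  \sum_(i < n) f i * chord c d w w' i j
  = (j == c)%:R * w * f d + (j == d)%:R * w' * f c.
Proof.
move=> ltcn ltdn.
have E i : f i * chord c d w w' i j
    = (j == c)%:R * w * (f i * (i == d)%:R) + (j == d)%:R * w' * (f i * (i == c)%:R).
  by rewrite /chord -!mulnb !natrM; ring.
under eq_bigr => i _ do rewrite E.
by rewrite big_split -!mulr_sumr !sum_delta ltcn ltdn !mul1r.
Qed.

(** The default 0 outside the range lets [j.-1] and [j.+1] be used as indices without bound
    proofs. *)
Definition row_ext (F : pzRingType) n (x : 'rV[F]_n) (i : nat) : F :=
  if insub i is Some k then x 0 k else 0.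

Lemma row_extE (F : pzRingType) n (x : 'rV[F]_n) (i : 'I_n) :
  row_ext x i = x 0 i.
Proof. by rewrite /row_ext valK. Qed.

Lemma alternate (T : Type) (f : nat -> T) a b :
  (forall j, (a < j < b)%N -> f j.+1 = f j.-1) ->
  forall i, (a + i <= b)%N -> f (a + i)%N = if odd i then f a.+1 else f a.
Proof.
move=> fE; elim/ltn_ind => -[|[|i]] IH le_b; rewrite ?addn0 ?addn1 //.
rewrite !addnS fE /=; last by lia.
rewrite negbK IH //; lia.
Qed.

(** * Kernel of the rescaled matrix of infty(p, q, l) *)

Section InftyKernel.

Variables (F : realFieldType) (c m q : nat) (e1 e2 d1 d2 : F).
Hypotheses (c_ge2 : (2 <= c)%N) (le_cm : (c <= m)%N) (q_ge3 : (3 <= q)%N).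


(** Here [c] is the last vertex of the left cycle and [m] the first one of the right cycle; the two
    chords are the closing edges of the cycles. *)
Definition infty_mx : 'M[F]_(m + q) :=
  \matrix_(i, j) (skew_path F i j + chord 0 c e1 e2 i j
                  + chord m (m + q).-1 d1 d2 i j).

(** The factors [(0 < j)] and [(j.+1 < m + q)] remove the missing neighbours at the two ends of the
    Hamiltonian path; at vertex 0, [j.-1] would be 0 again. *)
Definition infty_eqs (f : nat -> F) :=
  forall j, (j < m + q)%N ->
  (0 < j)%N%:R * f j.-1 - (j.+1 < m + q)%N%:R * f j.+1
  + ((j == 0%N)%:R * e1 * f c + (j == c)%:R * e2 * f 0)
  + ((j == m)%:R * d1 * f (m + q).-1 + (j == (m + q).-1)%:R * d2 * f m) = 0.

Lemma infty_mx_row (f : nat -> F) :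
  (\row_i f i) *m infty_mx = 0 <-> infty_eqs f.
Proof.
have E (j : 'I_(m + q)) :
    ((\row_i f i) *m infty_mx) 0 j =
    (0 < j)%N%:R * f j.-1 - (j.+1 < m + q)%N%:R * f j.+1
  + ((val j == 0%N)%:R * e1 * f c + (val j == c)%:R * e2 * f 0)
  + ((val j == m)%:R * d1 * f (m + q).-1 + (val j == (m + q).-1)%:R * d2 * f m).
  rewrite mxE; under eq_bigr => i _ do rewrite !mxE mulrDr mulrDr.
  by rewrite !big_split /= sum_skew_path // !sum_chord //; lia.
split=> [/rowP f0 j ltj | f0].
  by have := f0 (Ordinal ltj); rewrite E mxE.
by apply/rowP => j; rewrite E mxE f0.
Qed.

(* Here t = [:: u_0; u_1; u_(m+q-1)], and bc, bk, bq are the parities of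
   c = p - 1, m - c = l - 1 and q - 1.  The even (odd) value is the one taken at
   even (odd) distance from the left end c of the path, resp. m of the right
   cycle.  For l = 1 the odd value of the path is taken nowhere: it is
   u_(c-1) + e2 u_0, the contribution of C_p to the equation at c = m. *)
Definition mid_even (bc : bool) (t : seq F) := if bc then t`_1 else t`_0.
Definition mid_odd (bc : bool) (t : seq F) :=
  (if bc then t`_0 else t`_1) + e2 * t`_0.
Definition right_even (bc bk : bool) (t : seq F) :=
  if bk then mid_odd bc t else mid_even bc t.
Definition right_odd (bc bk : bool) (t : seq F) :=
  (if bk then mid_even bc t else mid_odd bc t) + d1 * t`_2.
(** In order: the equation at vertex 0, the agreement of u_(m+q-1) with the periodic continuation,
    and the equation at the last vertex. The equations at [c] and [m] are built into [mid_odd] and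
    [right_odd]. *)
Definition infty_cond (bc bk bq : bool) (t : seq F) :=
  [/\ t`_1 = e1 * mid_even bc t,
      t`_2 = (if bq then right_odd bc bk t else right_even bc bk t)
    & (if bq then right_even bc bk t else right_odd bc bk t)
       + d2 * right_even bc bk t = 0].

Let bc := odd c.
Let bk := odd (m - c).
Let bq := odd q.-1.

Definition infty_sol (t : seq F) (i : nat) : F :=
  if (i <= c)%N then (if odd i then t`_1 else t`_0)
  else if (i <= m)%N then (if odd (i - c) then mid_odd bc t else mid_even bc t)
  else (if odd (i - m) then right_odd bc bk t else right_even bc bk t).

Lemma infty_sol_mid t i : (c <= i <= m)%N ->
  infty_sol t i = if odd (i - c) then mid_odd bc t else mid_even bc t.
Proof.
move=> /andP[ci im]; rewrite /infty_sol im.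
by case: (ltngtP i c) ci => // -> _; rewrite subnn.
Qed.

Lemma infty_sol_right t i : (m <= i)%N ->
  infty_sol t i = if odd (i - m) then right_odd bc bk t else right_even bc bk t.
Proof.
rewrite leq_eqVlt => /predU1P[<-|lt_mi].
  by rewrite infty_sol_mid ?leqnn ?le_cm // subnn.
by rewrite /infty_sol [(i <= m)%N]leqNgt lt_mi [(i <= c)%N]leqNgt (leq_ltn_trans le_cm lt_mi).
Qed.

Lemma infty_sol_last t : infty_sol t (m + q).-1 =
  if bq then right_odd bc bk t else right_even bc bk t.
Proof.
by rewrite infty_sol_right; [have -> : ((m + q).-1 - m = q.-1)%N by lia | lia].
Qed.

Lemma infty_eqs_sol t : infty_cond bc bk bq t -> infty_eqs (infty_sol t).
Proof.
move=> [t1E t2E t3E] j lt_jn.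
have sol0 : infty_sol t 0 = t`_0 by [].
have solc : infty_sol t c = mid_even bc t by rewrite infty_sol_mid ?leqnn ?subnn.
have solm : infty_sol t m = right_even bc bk t.
  by rewrite infty_sol_right ?leqnn ?subnn.
have soln : infty_sol t (m + q).-1 = t`_2 by rewrite infty_sol_last -t2E.
have soln1 : infty_sol t (m + q).-2 =
    if bq then right_even bc bk t else right_odd bc bk t.
  rewrite infty_sol_right; last by lia.
  have -> : ((m + q).-2 - m = q.-2)%N by lia.
  rewrite /bq; have -> : odd q.-1 = ~~ odd q.-2 by lia.
  by case: odd.
have solm1 : infty_sol t m.+1 = right_odd bc bk t.
  by rewrite infty_sol_right // subSnn.
have solc1 : infty_sol t c.-1 + e2 * t`_0 = mid_odd bc t.
  rewrite /infty_sol leq_pred /mid_odd /bc.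
  have -> : odd c.-1 = ~~ odd c by lia.
  by case: odd.
rewrite sol0 solc solm soln.
have [->|j_gt0] := posnP j.
  rewrite mul0r.
  have -> : (1 < m + q)%N by lia.
  have -> : (0%N == c) = false by lia.
  have -> : (0%N == m) = false by lia.
  have -> : (0%N == (m + q).-1) = false by lia.
  have -> : infty_sol t 1 = t`_1 by rewrite /infty_sol (ltnW c_ge2).
  by rewrite t1E /=; ring.
have [jn|jn] := eqVneq j (m + q).-1.
  rewrite jn; have -> : ((m + q).-1.+1 < m + q)%N = false by lia.
  have -> : ((m + q).-1 == c)%N = false by lia.
  have -> : ((m + q).-1 == m)%N = false by lia.
  by rewrite soln1; apply: etrans t3E; rewrite /=; ring.
have -> : (j.+1 < m + q)%N by lia.
(* The first case is l = 1, where both closing edges contribute to the same equation. *)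
have [jc|jc] := eqVneq j c; have [jm|jm] := eqVneq j m.
- rewrite {2}jm solm1 jc /right_odd /bk -jm jc subnn -solc1 /=; ring.
- rewrite jc.
  have -> : infty_sol t c.+1 = mid_odd bc t.
    by rewrite infty_sol_mid ?subSnn //; lia.
  by rewrite -solc1 /=; ring.
- suff -> : infty_sol t j.+1 = infty_sol t j.-1 + d1 * t`_2 by rewrite /=; ring.
  rewrite jm solm1 infty_sol_mid /right_odd /bk; last by lia.
  have -> : odd (m.-1 - c) = ~~ odd (m - c) by lia.
  by case: odd.
(* At any other vertex both neighbours belong to the same piece and have the same parity there. *)
- suff -> : infty_sol t j.-1 = infty_sol t j.+1 by rewrite /=; ring.
  have [lt_jc|le_cj] := ltnP j c.
    rewrite /infty_sol lt_jc (leq_trans (leq_pred j) (ltnW lt_jc)).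
    by have -> : odd j.-1 = odd j.+1 by lia.
  have [lt_jm|le_mj] := ltnP j m.
    rewrite !infty_sol_mid; try lia.
    by have -> : odd (j.-1 - c) = odd (j.+1 - c) by lia.
  rewrite !infty_sol_right; try lia.
  by have -> : odd (j.-1 - m) = odd (j.+1 - m) by lia.
Qed.

(** The pieces are determined from left to right: the inner equations propagate two consecutive
    values through a piece, and the equation at its right end yields the second value of the next
    piece. *)
Lemma infty_eqs_solve f (t := [:: f 0; f 1; f (m + q).-1]) :
  infty_eqs f ->
  (forall i, (i < m + q)%N -> f i = infty_sol t i) /\ infty_cond bc bk bq t.
Proof.
move=> fE.
have inner j : (0 < j < (m + q).-1)%N -> j != c -> j != m -> f j.+1 = f j.-1.
  move=> /andP[j_gt0 j_lt] /negPf jc /negPf jm.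
  have := fE j; rewrite jc jm j_gt0.
  have -> : (j < m + q)%N by lia.
  have -> : (j.+1 < m + q)%N by lia.
  have -> : (j == 0)%N = false by lia.
  have -> : (j == (m + q).-1)%N = false by lia.
  by move=> /(_ isT) /=; lra.
have left i : (i <= c)%N -> f i = infty_sol t i.
  move=> le_ic; rewrite /infty_sol le_ic -[i]add0n.
  apply: (@alternate _ _ 0 c) => // j /andP[j0 jc].
  by apply: inner; lia.
have fc : f c = mid_even bc t by rewrite left // infty_sol_mid ?leqnn ?subnn.
have fc1 : f c.-1 + e2 * f 0 = mid_odd bc t.
  rewrite left ?leq_pred // /infty_sol leq_pred /mid_odd /bc.
  have -> : odd c.-1 = ~~ odd c by lia.
  by case: odd.
have f1 : f 1 = e1 * mid_even bc t.
  have := fE 0%N; rewrite /= fc.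
  have -> : (0 < m + q)%N by lia.
  have -> : (1 < m + q)%N by lia.
  have -> : (0%N == c) = false by lia.
  have -> : (0%N == m) = false by lia.
  have -> : (0%N == (m + q).-1) = false by lia.
  by move=> /(_ isT) /=; lra.
have mid i : (c <= i <= m)%N -> f i = infty_sol t i.
  move=> /andP[ci im]; rewrite infty_sol_mid ?ci //.
  have [lt_cm|le_mc] := ltnP c m; last first.
    have -> : i = c by lia.
    by rewrite fc subnn.
  have fcS : f c.+1 = mid_odd bc t.
    have := fE c; rewrite -fc1 eqxx.
    have -> : (0 < c)%N by lia.
    have -> : (c < m + q)%N by lia.
    have -> : (c.+1 < m + q)%N by lia.
    have -> : (c == 0)%N = false by lia.
    have -> : (c == m)%N = false by lia.
    have -> : (c == (m + q).-1)%N = false by lia.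
    by move=> /(_ isT) /=; lra.
  rewrite -{1}(subnKC ci) (@alternate _ f c m) ?subnKC ?fc ?fcS // => j jE.
  by apply: inner; lia.
have fm : f m = right_even bc bk t.
  by rewrite mid ?leqnn ?le_cm // infty_sol_right // subnn.
have fm1 : f m.+1 = right_odd bc bk t.
  have := fE m; rewrite eqxx.
  have -> : (0 < m)%N by lia.
  have -> : (m < m + q)%N by lia.
  have -> : (m.+1 < m + q)%N by lia.
  have -> : (m == 0)%N = false by lia.
  have -> : (m == (m + q).-1)%N = false by lia.
  move=> /(_ isT).
  (* The closing edge of the left cycle enters the equation at [m] exactly when [m = c], that is,
     when l = 1. *)
  have -> : right_odd bc bk t = f m.-1 + (m == c)%:R * e2 * f 0 + d1 * f (m + q).-1.
    rewrite /right_odd /= /bk; congr (_ + _).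
    have [->|mc] := eqVneq m c; first by rewrite subnn -fc1 mul1r.
    rewrite mid ?infty_sol_mid; try lia.
    have -> : odd (m.-1 - c) = ~~ odd (m - c) by lia.
    by case: odd => /=; ring.
  by case: (m == c) => /=; lra.
have right i : (m <= i < m + q)%N -> f i = infty_sol t i.
  move=> /andP[mi lt_i]; rewrite infty_sol_right //.
  rewrite -{1}(subnKC mi) (@alternate _ f m (m + q).-1) ?fm ?fm1 // => [j jE|].
    by apply: inner; lia.
  by lia.
split=> [i lt_i|].
  have [le_ic|lt_ci] := leqP i c; first exact: left.
  have [le_im|lt_mi] := leqP i m; first by apply: mid; lia.
  by apply: right; lia.
split; first by [].
  by rewrite -infty_sol_last -right //; lia.
have := fE (m + q).-1.
rewrite eqxx; have -> : ((m + q).-1.+1 < m + q)%N = false by lia.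
have -> : ((m + q).-1 < m + q)%N by lia.
have -> : ((m + q).-1 == 0)%N = false by lia.
have -> : ((m + q).-1 == c)%N = false by lia.
have -> : ((m + q).-1 == m)%N = false by lia.
have -> : (0 < (m + q).-1)%N by lia.
move=> /(_ isT); rewrite -fm right; last by lia.
rewrite infty_sol_right; last by lia.
have -> : odd ((m + q).-2 - m) = ~~ bq by rewrite /bq; lia.
by rewrite if_neg -fm; case: bq => /=; lra.
Qed.

(** This transfers [rank_kermx_free] to triples: [cs] lists coordinates of [t] that determine a
    solution, and [ts] is a family of solutions dual to them. *)
Lemma rank_kermx_infty (cs : seq nat) (ts : seq (seq F)) :
    size ts = size cs -> all (ltn^~ 3) cs ->
    (forall t, t \in ts -> infty_cond bc bk bq t) ->
    (forall i j, (i < size cs)%N -> (j < size cs)%N ->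
       (nth [::] ts i)`_(nth 0%N cs j) = (i == j)%:R) ->
    (forall t, infty_cond bc bk bq t -> (forall k, k \in cs -> t`_k = 0) ->
       [/\ t`_0 = 0, t`_1 = 0 & t`_2 = 0]) ->
  \rank (kermx infty_mx) = size cs.
Proof.
move=> sz_ts cs3 condt tdelta t0.
(* The vertices carrying the three coordinates of [t]. *)
have lt_pos k : (k < 3)%N -> (nth 0 [:: 0; 1; (m + q).-1] k < m + q)%N.
  by case: k => [|[|[|]]] //= _; lia.
have cs_lt (j : 'I_(size cs)) : (nth 0%N cs j < 3)%N by apply: (all_nthP _ cs3).
pose pos (j : 'I_(size cs)) := Ordinal (lt_pos _ (cs_lt j)).
have pos_sol t k : infty_cond bc bk bq t -> (k < 3)%N ->
    infty_sol t (nth 0 [:: 0; 1; (m + q).-1] k)%N = t`_k.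
  move=> [_ t2 _]; case: k => [|[|[|]]] //= _.
    by rewrite /infty_sol (ltnW c_ge2).
  by rewrite infty_sol_last.
apply: (@rank_kermx_free _ _ _ _ pos (fun i => \row_j infty_sol (nth [::] ts i) j)).
- by move=> i; apply/infty_mx_row/infty_eqs_sol/condt/mem_nth; rewrite sz_ts.
- move=> i j; rewrite mxE /= pos_sol ?tdelta //.
  by apply/condt/mem_nth; rewrite sz_ts.
move=> x x0 xpos.
have xE : x = \row_i row_ext x i by apply/rowP => i; rewrite mxE row_extE.
move: x0; rewrite {1}xE => /infty_mx_row/infty_eqs_solve[xsol cond].
have posE k : k \in cs -> [:: row_ext x 0; row_ext x 1; row_ext x (m + q).-1]`_k = 0.
  move=> k_cs; have k_lt : (index k cs < size cs)%N by rewrite index_mem.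
  have := xpos (Ordinal k_lt); rewrite -row_extE /= nth_index //.
  by have := allP cs3 _ k_cs; case: k {k_cs k_lt} => [|[|[|]]].
have [/= x0 x1 x2] := t0 _ cond posE.
apply/rowP => i; rewrite -row_extE mxE xsol // x0 x1 x2.
rewrite /infty_sol /right_odd /right_even /mid_odd /mid_even /=.
by rewrite !if_same !mulr0 !addr0 !if_same.
Qed.

End InftyKernel.

(* The positions in t on which the solutions are free. *)
Definition infty_coords (bc bk bq b d : bool) : seq nat :=
  match bc, bq with
  | false, false => if ~~ bk && (b != d) then [:: 0] else [::]
  | true, false => if b then [::] else [:: 0]
  | false, true => if d then [::] else [:: 2]
  | true, true =>
    if bk then (if b && d then [::] else [:: 0; 2])
    else if b then (if d then [:: 0] else [:: 2])
    else if d then [:: 0] else [:: 0; 1; 2]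
  end%N.

(** Solutions dual to [infty_coords] for closing weights (-1)^b and (-1)^d; the entries at the other
    positions are forced by [infty_cond]. *)
Definition infty_basis (F : pzRingType) (bc bk bq b d : bool) : seq (seq F) :=
  match bc, bq with
  | false, false => if ~~ bk && (b != d) then [:: [:: 1; (-1) ^+ b; 1]] else [::]
  | true, false => if b then [::] else [:: [:: 1; 0; 0]]
  | false, true => if d then [::] else [:: [:: 0; 0; 1]]
  | true, true =>
    if bk then
      if b && d then [::]
      else [:: [:: 1; 0; 0]; [:: 0; if d then 2 else 0; 1]]
    else if b then [:: if d then [:: 1; 0; 1] else [:: 0; 0; 1]]
    else if d then [:: [:: 1; 0; 0]]
    else [:: [:: 1; 0; 0]; [:: 0; 1; 0]; [:: 0; 0; 1]]
  end.

Definition cycle_mx (F : pzRingType) p (e1 e2 : F) : 'M[F]_p :=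
  \matrix_(i, j) (skew_path F i j + chord 0 p.-1 e1 e2 i j).

Lemma cycle_mx_row (F : comPzRingType) p (e1 e2 : F) (f : nat -> F) :
  (0 < p)%N ->
  (\row_i f i) *m cycle_mx p e1 e2 = 0 <->
  forall j, (j < p)%N ->
  (0 < j)%N%:R * f j.-1 - (j.+1 < p)%N%:R * f j.+1
  + ((j == 0%N)%:R * e1 * f p.-1 + (j == p.-1)%:R * e2 * f 0) = 0.
Proof.
move=> p_gt0; have E (j : 'I_p) :
    ((\row_i f i) *m cycle_mx p e1 e2) 0 j =
    (0 < j)%N%:R * f j.-1 - (j.+1 < p)%N%:R * f j.+1
  + ((val j == 0%N)%:R * e1 * f p.-1 + (val j == p.-1)%:R * e2 * f 0).
  rewrite mxE; under eq_bigr => i _ do rewrite !mxE mulrDr.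
  by rewrite big_split /= sum_skew_path // sum_chord //; lia.
split=> [/rowP f0 j ltj | f0].
  by have := f0 (Ordinal ltj); rewrite E mxE.
by apply/rowP => j; rewrite E mxE f0.
Qed.

(** A kernel vector alternates between two values, and since [p] is even the two closing equations
    require each value to equal (-1)^b times itself. *)
Lemma cycle_mx_even_nullity (F : realFieldType) p (b : bool) :
  (3 <= p)%N -> ~~ odd p ->
  \rank (kermx (cycle_mx p ((-1) ^+ b : F) (- (-1) ^+ b))) = if b then 0%N else 2.
Proof.
move=> p3 p_even; have p_gt0 : (0 < p)%N by lia.
have p1_odd : odd p.-1 by lia.
have lt1p : (1 < p)%N by lia.
set A := cycle_mx _ _ _.
have solve (x : 'rV_p) (f := row_ext x) : x *m A = 0 ->
    [/\ forall i : 'I_p, x 0 i = if odd i then f 1%N else f 0%N,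
        f 1%N = (-1) ^+ b * f 1%N & f 0%N = (-1) ^+ b * f 0%N].
  have xE : x = \row_i f i by apply/rowP => i; rewrite mxE /f row_extE.
  rewrite {1}xE => /(cycle_mx_row _ _ _ p_gt0) fE.
  have fi i : (i < p)%N -> f i = if odd i then f 1%N else f 0%N.
    move=> lt_i; rewrite -[in LHS](add0n i).
    apply: (@alternate _ f 0 p.-1) => [j /andP[j0 j_lt]|]; last by lia.
    have := fE j; rewrite j0.
    have -> : (j < p)%N by lia.
    have -> : (j.+1 < p)%N by lia.
    have -> : (j == 0)%N = false by lia.
    have -> : (j == p.-1)%N = false by lia.
    by move=> /(_ isT) /=; lra.
  split=> [i||]; first by rewrite -fi // /f row_extE.
    have := fE 0%N p_gt0; rewrite lt1p (fi p.-1); last by lia.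
    have -> : (0%N == p.-1) = false by lia.
    by rewrite p1_odd /=; lra.
  have := fE p.-1; rewrite eqxx (fi p.-2); last by lia.
  have -> : odd p.-2 = false by lia.
  have -> : (p.-1.+1 < p)%N = false by lia.
  have -> : (p.-1 < p)%N by lia.
  have -> : (p.-1 == 0)%N = false by lia.
  have -> : (0 < p.-1)%N by lia.
  by move=> /(_ isT) /=; lra.
case: b @A solve => A solve.
  apply: (@rank_kermx_free _ _ _ _ (fun i : 'I_0 => Ordinal lt1p) (fun _ => 0)) => [[]//|[]//|x].
  move=> /solve[xE /= f1 f0] _; apply/rowP => i; rewrite xE mxE.
  by case: odd; lra.
(* The free coordinates are at vertices 0 and 1, and the dual solutions are the indicators of the
   two parity classes. *)
pose c (i : 'I_2) : 'I_p := widen_ord lt1p i.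
apply: (@rank_kermx_free _ _ _ _ c (fun i => \row_j (odd j == odd i)%:R)).
- move=> i; apply/(cycle_mx_row _ _ (fun j => (odd j == odd i)%:R)) => // j lt_j.
  have [->|j0] := posnP j.
    rewrite lt1p p1_odd.
    have -> : (0%N == p.-1) = false by lia.
    by rewrite /=; ring.
  have [->|jp] := eqVneq j p.-1.
    have -> : odd p.-2 = false by lia.
    have -> : (p.-1.+1 < p)%N = false by lia.
    by rewrite /=; ring.
  have -> : (j.+1 < p)%N by lia.
  have -> : odd j.-1 = odd j.+1 by lia.
  by rewrite /=; ring.
- by move=> [[|[|]]] // ? [[|[|]]] // ?; rewrite mxE.
move=> x /solve[xE _ _] x0; apply/rowP => i; rewrite xE mxE.
have fc k : row_ext x (c k) = 0 by rewrite row_extE x0.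
by case: odd; [have := fc 1 | have := fc 0].
Qed.

(** Only five bits matter, and for each of the 32 choices the conditions are linear with explicit
    coefficients. *)
Lemma infty_mx_nullity (F : realFieldType) c m q (b d : bool)
    (e := (-1) ^+ b : F) (f := (-1) ^+ d : F) :
    (2 <= c)%N -> (c <= m)%N -> (3 <= q)%N ->
  \rank (kermx (infty_mx c m q e ((-1) ^+ odd c * e) f ((-1) ^+ odd q.-1 * f)))
  = size (infty_coords (odd c) (odd (m - c)) (odd q.-1) b d).
Proof.
move=> c2 cm q3; rewrite {}/e {}/f.
apply: (rank_kermx_infty c2 cm q3
          (ts := infty_basis F (odd c) (odd (m - c)) (odd q.-1) b d)).
- by case: (odd c) (odd (m - c)) (odd q.-1) b d => [] [] [] [] [].
- by case: (odd c) (odd (m - c)) (odd q.-1) b d => [] [] [] [] [].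
- move=> t.
  rewrite /infty_cond /right_odd /right_even /mid_odd /mid_even.
  move: (odd c) (odd (m - c)) (odd q.-1) => bc bk bq.
  case: bc bk bq b d => [] [] [] [] []; rewrite /= ?expr0 ?expr1 ?inE //;
    do ?[case/orP => [/eqP ->|]]; try move/eqP->; by split=> /=; lra.
- move: (odd c) (odd (m - c)) (odd q.-1) => bc bk bq.
  by case: bc bk bq b d => [] [] [] [] [] [|[|[|i]]] // [|[|[|j]]] //.
- move=> t; rewrite /infty_cond /right_odd /right_even /mid_odd /mid_even.
  move: (odd c) (odd (m - c)) (odd q.-1) => bc bk bq cond t0.
  move: (t0 0%N) (t0 1%N) (t0 2%N) cond.
  case: bc bk bq b d {t0} => [] [] [] [] []; rewrite /= ?inE /= ?expr0 ?expr1 => x0 x1 x2 [? ? ?];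
    try move: (x0 isT) => ?; try move: (x1 isT) => ?; try move: (x2 isT) => ?; split; lra.
Qed.

Local Close Scope ring_scope.

(** * Edges and signs *)

Lemma eq_set2 (T : finType) (a b c d : T) :
  ([set a; b] == [set c; d]) = (a == c) && (b == d) || (a == d) && (b == c).
Proof.
apply/eqP/orP => [E|[]/andP[/eqP-> /eqP->] //]; last exact: setUC.
have : d \in [set a; b] by rewrite E set22.
have : c \in [set a; b] by rewrite E set21.
have /set2P[->|->] : a \in [set c; d] by rewrite -E set21.
  have /set2P[->|->] : b \in [set c; d] by rewrite -E set22.
    by move=> _ /set2P[] ->; rewrite eqxx; left.
  by rewrite !eqxx; left.
have /set2P[->|->] : b \in [set c; d] by rewrite -E set22.
  by rewrite !eqxx; right.
by move=> /set2P[] -> _; rewrite eqxx; left.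
Qed.

(** Natural numbers as end points avoid bound proofs in sums over consecutive edges; a number out of
    range contributes no vertex. *)
Definition nat_edge n (x y : nat) : {set 'I_n} :=
  [set i | (val i == x) || (val i == y)].

Lemma nat_edgeE n (i j : 'I_n) : [set i; j] = nat_edge n i j.
Proof. by apply/setP => k; rewrite !inE. Qed.

Lemma nat_edgeC n x y : nat_edge n x y = nat_edge n y x.
Proof. by apply/setP => k; rewrite !inE orbC. Qed.

Lemma imset_nat_edge p n (f : 'I_p -> 'I_n) a x y :
  (forall i, f i = a + i :> nat) -> x < p -> y < p ->
  f @: nat_edge p x y = nat_edge n (a + x) (a + y).
Proof.
move=> fE ltx lty.
rewrite -(nat_edgeE (Ordinal ltx) (Ordinal lty)) imsetU1 imset_set1 nat_edgeE.
by rewrite !fE.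
Qed.

Lemma val_ordS n (i : 'I_n) : val (ordS i) = if i.+1 == n then 0 else i.+1.
Proof.
rewrite /=; case: eqP => [->|ne]; first by rewrite modnn.
by rewrite modn_small //; have := ltn_ord i; lia.
Qed.

(** Edges of a cycle on the vertices a, ..., a + p - 1, oriented from the smaller end to the larger:
    the consecutive pairs and the closing pair. *)
Definition cycle_arc a p x y :=
  (a <= x) && (y == x.+1) && (y < a + p) || (x == a) && (y == (a + p).-1).

Lemma mem_map_cycle p n (f : 'I_p -> 'I_n) a (x y : 'I_n) :
  3 <= p -> (forall i, f i = a + i :> nat) ->
  ([set x; y] \in map_graph f (cycle_graph p)) = cycle_arc a p x y || cycle_arc a p y x.
Proof.
move=> p3 fE; apply/imsetP/idP => [[e /imsetP[i _ ->]]|].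
  rewrite imsetU1 imset_set1 => /eqP; rewrite eq_set2 -!val_eqE /= !fE val_ordS.
  by rewrite /cycle_arc; have := ltn_ord i; case: (i.+1 =P p); lia.
wlog: x y / cycle_arc a p x y => [IH|xy _].
  by case/orP => xy; [|rewrite setUC]; apply: IH; rewrite ?xy.
have ltx : x - a < p by move: xy; rewrite /cycle_arc; lia.
have lty : y - a < p by move: xy; rewrite /cycle_arc; lia.
exists [set Ordinal ltx; Ordinal lty]; last first.
  by rewrite imsetU1 imset_set1; apply/eqP; rewrite eq_set2 -!val_eqE /= !fE /=;
    move: xy; rewrite /cycle_arc; lia.
have /orP[xy'|xy'] := xy.
  apply/imsetP; exists (Ordinal ltx) => //.
  by apply/eqP; rewrite eq_set2 -!val_eqE val_ordS /=; case: (_.+1 =P p); lia.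
apply/imsetP; exists (Ordinal lty) => //.
by apply/eqP; rewrite eq_set2 -!val_eqE val_ordS /=; case: (_.+1 =P p); lia.
Qed.

Lemma mem_cycle p (x y : 'I_p) : 3 <= p ->
  ([set x; y] \in cycle_graph p) = cycle_arc 0 p x y || cycle_arc 0 p y x.
Proof.
move=> p3; rewrite -(@mem_map_cycle _ _ id) // /map_graph.
suff -> : [set id @: e | e : {set 'I_p} in cycle_graph p] = cycle_graph p by [].
by rewrite -[RHS]imset_id; apply: eq_imset => e; rewrite imset_id.
Qed.

Lemma mem_map_path l n (f : 'I_l -> 'I_n) a (x y : 'I_n) :
  (forall i, f i = a + i :> nat) ->
  ([set x; y] \in map_graph f (path_graph l))
  = (a <= x) && (val y == x.+1) && (y < a + l)
    || (a <= y) && (val x == y.+1) && (x < a + l).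
Proof.
move=> fE; apply/imsetP/idP => [[e /imsetP[[i j] /[!inE] /= /eqP ij ->]]|].
  rewrite imsetU1 imset_set1 => /eqP; rewrite eq_set2 -!val_eqE /= !fE.
  by have := ltn_ord i; have := ltn_ord j; lia.
wlog: x y / (a <= x) && (val y == x.+1) && (y < a + l) => [IH|xy _].
  by case/orP => xy; [|rewrite setUC]; apply: IH; rewrite ?xy.
rewrite /= in xy.
have ltx : x - a < l by lia.
have lty : y - a < l by lia.
exists [set Ordinal ltx; Ordinal lty]; last first.
  by rewrite imsetU1 imset_set1; apply/eqP; rewrite eq_set2 -!val_eqE /= !fE /=; lia.
by apply/imsetP; exists (Ordinal ltx, Ordinal lty) => //; rewrite inE /=; lia.
Qed.

(** The consecutive edges of the left cycle, of the path and of the right cycle together exhaust all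
    consecutive pairs of vertices, which leaves the two closing edges. *)
Lemma mem_infty p q l (x y : 'I_(infty_order p q l)) (m := p + l - 2) :
  3 <= p -> 3 <= q -> 1 <= l ->
  ([set x; y] \in infty_graph p q l)
  = [|| x.+1 == y, y.+1 == x, (val x == 0) && (val y == p.-1),
        (val y == 0) && (val x == p.-1),
        (val x == m) && (val y == (m + q).-1)
      | (val y == m) && (val x == (m + q).-1)].
Proof.
move=> p3 q3 l1; rewrite !in_setU.
rewrite (mem_map_cycle (a := 0)) //; last exact: infty_leftE.
rewrite (mem_map_path (a := p - 1)) //; last exact: infty_midE.
rewrite (mem_map_cycle (a := p + l - 2)) //; last exact: infty_rightE.
have lt_n (z : 'I_(infty_order p q l)) : z < m + q.
  by have := ltn_ord z; rewrite /m [X in _ < X]infty_orderE //; lia.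
have arcE (u v : 'I_(infty_order p q l)) :
    [|| cycle_arc 0 p u v, (p - 1 <= u) && (val v == u.+1) && (v < p - 1 + l)
      | cycle_arc (p + l - 2) q u v]
    = [|| u.+1 == v, (val u == 0) && (val v == p.-1)
        | (val u == m) && (val v == (m + q).-1)].
  have := lt_n v; rewrite /cycle_arc [u.+1 == v]eq_sym -/m add0n /=.
  case: (v =P u.+1 :> nat) => [->|_ _]; last by rewrite !andbF.
  rewrite !andbT /= => lt_u.
  (* A consecutive pair lies in the left cycle, the path or the right cycle according to its larger
     end. *)
  have [lt_p|] := ltnP u.+1 p; first by [].
  have [lt_m|] := ltnP u.+1 (p - 1 + l).
    move=> ?; have -> : p - 1 <= u by lia.
    by rewrite orbT.
  move=> ? ?; have -> : m <= u by lia.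
  by rewrite lt_u /= !orbT.
have orACA (a b c d e f : bool) :
    (a || b) || (c || d) || (e || f) = [|| a, c | e] || [|| b, d | f].
  by case: a b c d e f => [] [] [] [] [] [].
by rewrite orACA !arcE -orACA -!orbA.
Qed.

(** * Negative edges along the Hamiltonian path and the rescaling signs *)

Definition path_signs n (sigma : signing n) (i : nat) : nat :=
  \sum_(k < i) sigma (nat_edge n k k.+1).

Lemma negative_edges_cycle p (sigma : signing p) : 3 <= p ->
  negative_edges (cycle_graph p) sigma
  = path_signs sigma p.-1 + sigma (nat_edge p 0 p.-1).
Proof.
move=> p3; rewrite /negative_edges -sum1dep_card.
rewrite (eq_bigl (fun e => (e \in cycle_graph p) && sigma e)) //.
(* Since p >= 3, distinct vertices [i] give distinct edges from [i] to its successor, so edges can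
   be counted by vertices. *)
rewrite big_mkcondr big_imset /=; last first.
  move=> i j _ _ /eqP; rewrite eq_set2 -!val_eqE !val_ordS.
  move=> ij; apply/val_inj; move: ij; have := ltn_ord i; have := ltn_ord j.
  by move=> /=; do 2!case: ifP => /eqP; lia.
have E (i : 'I_p) : (if sigma [set i; ordS i] then 1 else 0)
    = (sigma (nat_edge p i (if i.+1 == p then 0 else i.+1)) : nat).
  by rewrite nat_edgeE val_ordS; case: (sigma _).
under eq_bigr => i _ do rewrite E.
rewrite /path_signs.
pose F k := nat_of_bool (sigma (nat_edge p k (if k.+1 == p then 0 else k.+1))).
rewrite (eq_bigr (fun i : 'I_p => F i)) //.
(* Only the last index wraps around; it gives the closing edge. *)
rewrite -(big_mkord xpredT F) -{1}(prednK (ltnW (ltnW p3))) big_nat_recr //=.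
rewrite big_mkord /F (prednK (ltnW (ltnW p3))) eqxx nat_edgeC; congr (_ + _).
apply: eq_bigr => i _; have := ltn_ord i; case: (i.+1 =P p) => //; lia.
Qed.

Local Open Scope ring_scope.

Lemma path_signsS n (sigma : signing n) i :
  path_signs sigma i.+1 = (path_signs sigma i + sigma (nat_edge n i i.+1))%N.
Proof. by rewrite /path_signs big_ord_recr. Qed.

Lemma path_signs_inherit p n (f : 'I_p -> 'I_n) (sigma : signing n) a k :
  (forall i, f i = a + i :> nat)%N -> (k < p)%N ->
  path_signs sigma (a + k) = (path_signs sigma a + path_signs (inherit f sigma) k)%N.
Proof.
move=> fE; elim: k => [|k IH] lt_k.
  by rewrite addn0 /path_signs big_ord0 addn0.
rewrite addnS !path_signsS (IH (ltnW lt_k)) addnA; congr (_ + nat_of_bool _)%N.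
by rewrite /inherit (imset_nat_edge fE) ?addnS // ltnW.
Qed.

(* Halving makes the scaling factors alternate in pairs, which turns the symmetric
   path matrix into the antisymmetric skew_path. *)
Definition gauge_l n (sigma : signing n) (i : nat) := (path_signs sigma i + i./2)%N.
Definition gauge_r n (sigma : signing n) (j : nat) := (path_signs sigma j + uphalf j).+1.

(** The edge signs cancel modulo 2. What remains is [i./2 + uphalf i.+1], which is odd, and the
    successor in [gauge_r] makes it even; in the opposite direction [j.+1./2 + uphalf j] is even,
    whence -1. *)
Lemma gauge_up (F : pzRingType) n (sigma : signing n) i :
  (-1) ^+ gauge_l sigma i * (-1) ^+ sigma (nat_edge n i i.+1)
  * (-1) ^+ gauge_r sigma i.+1 = 1 :> F.
Proof.
rewrite -!exprD -signr_odd (_ : odd _ = false) // /gauge_l /gauge_r path_signsS /=.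
lia.
Qed.

Lemma gauge_down (F : pzRingType) n (sigma : signing n) j :
  (-1) ^+ gauge_l sigma j.+1 * (-1) ^+ sigma (nat_edge n j.+1 j)
  * (-1) ^+ gauge_r sigma j = -1 :> F.
Proof.
rewrite nat_edgeC -!exprD -signr_odd (_ : odd _ = true) // /gauge_l /gauge_r path_signsS /=.
lia.
Qed.

(** As [i./2 + uphalf i = i], exchanging the two ends changes the exponent by d - c modulo 2. *)
Lemma gauge_chord (F : pzRingType) n (sigma : signing n) c d :
  (c <= d)%N ->
  (-1) ^+ gauge_l sigma c * (-1) ^+ sigma (nat_edge n c d) * (-1) ^+ gauge_r sigma d
  = (-1) ^+ odd (d - c) * ((-1) ^+ gauge_l sigma d * (-1) ^+ sigma (nat_edge n d c)
                           * (-1) ^+ gauge_r sigma c) :> F.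
Proof.
move=> cd; rewrite [nat_edge n d c]nat_edgeC -!exprD -signr_odd -[in RHS]signr_odd.
congr (_ ^+ nat_of_bool _); rewrite /gauge_l /gauge_r; lia.
Qed.

(** * From adjacency matrices to rescaled matrices *)

Lemma rank_kermx_gauge (F : fieldType) n (E : graph n) (sigma : signing n) :
  \rank (kermx (adjacency F E sigma))
  = \rank (kermx (\matrix_(i < n, j < n)
      if [set i; j] \in E then
        (-1) ^+ gauge_l sigma i * (-1) ^+ sigma (nat_edge n i j)
        * (-1) ^+ gauge_r sigma j
      else 0 : F)).
Proof.
rewrite (@rank_kermx_scale _ _ _ (fun i => (-1) ^+ gauge_l sigma i)
  (fun j => (-1) ^+ gauge_r sigma j)); try by move=> i; rewrite signr_eq0.
congr (\rank (kermx _)); apply/matrixP => i j; rewrite !mxE nat_edgeE.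
by case: ifP => _ //; rewrite mulr0 mul0r.
Qed.

(** The weight [e] is the rescaled entry from p - 1 to 0: the signs accumulated along the path and
    that of the closing edge add up to all negative edges, [p.-1./2] comes from [gauge_l], and the
    successor from [gauge_r] at 0. *)
Lemma nullity_cycle (F : realFieldType) p (sigma : signing p)
    (e := (-1) ^+ (negative_edges (cycle_graph p) sigma + p.-1./2).+1 : F) :
  (3 <= p)%N ->
  nullity F (cycle_graph p) sigma
  = \rank (kermx (cycle_mx p e ((-1) ^+ odd p.-1 * e))).
Proof.
move=> p3; rewrite nullityE rank_kermx_gauge; congr (\rank (kermx _)).
have eE : e = (-1) ^+ gauge_l sigma p.-1 * (-1) ^+ sigma (nat_edge p p.-1 0)
              * (-1) ^+ gauge_r sigma 0.
  rewrite /e negative_edges_cycle // nat_edgeC -!exprD -signr_odd -[in RHS]signr_odd.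
  congr (_ ^+ nat_of_bool _); rewrite /gauge_l /gauge_r /path_signs big_ord0; lia.
have eE' : (-1) ^+ odd p.-1 * e = (-1) ^+ gauge_l sigma 0
    * (-1) ^+ sigma (nat_edge p 0 p.-1) * (-1) ^+ gauge_r sigma p.-1.
  by rewrite gauge_chord // subn0 -eE.
apply/matrixP => i j; rewrite !mxE mem_cycle // /skew_path /chord.
have := ltn_ord i; have := ltn_ord j; rewrite /cycle_arc add0n.
move: (nat_of_ord i) (nat_of_ord j) => {}i {}j lt_j lt_i.
have [jE|ji] := eqVneq j i.+1.
  rewrite {}jE {j} in lt_j *.
  have -> : [|| (0 <= i) && true && (i.+1 < p) || (i == 0) && (i.+1 == p.-1),
      (0 <= i.+1) && (i == i.+2) && (i < p) | (i.+1 == 0) && (i == p.-1)]%N by lia.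
  have -> : (i.+2 == i)%N = false by lia.
  have -> : ((i == 0) && (i.+1 == p.-1))%N = false by lia.
  by rewrite gauge_up andbF /= !mulr0 subr0 !addr0.
have [iE|ij] := eqVneq i j.+1.
  rewrite {}iE {i ji} in lt_i *.
  have -> : ((j.+1 == p.-1) && (j == 0))%N = false by lia.
  have -> : (j.+1 < p)%N by lia.
  by rewrite gauge_down !andbT orbT /= !mulr0 sub0r !addr0.
rewrite !andbF /= subrr add0r.
have [->|i0] := eqVneq i 0%N.
  rewrite eE'.
  have -> : (0 == p.-1)%N = false by lia.
  by case: eqVneq => [->|_]; rewrite ?andbF /= !mulr0 ?mulr1 ?add0r ?addr0.
rewrite /= mulr0 addr0 eE.
have [->|_] := eqVneq i p.-1; last by rewrite andbF mulr0.
by case: eqVneq => [->|_]; rewrite /= ?mulr1 ?mulr0.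
Qed.

(** In the weight [f] of the entry from m + q - 1 to m, the negative edges before [m] are counted
    twice and cancel, which leaves those of C_q; the halves taken at both ends remain. *)
Lemma nullity_infty (F : realFieldType) p q l (sigma : signing (infty_order p q l))
    (m := (p + l - 2)%N)
    (s_p := negative_edges (cycle_graph p) (inherit (@infty_left p q l) sigma))
    (s_q := negative_edges (cycle_graph q) (inherit (@infty_right p q l) sigma))
    (e := (-1) ^+ (s_p + p.-1./2).+1 : F)
    (f := (-1) ^+ (s_q + (m + q).-1./2 + uphalf m).+1 : F) :
  (3 <= p)%N -> (3 <= q)%N -> (1 <= l)%N ->
  nullity F (infty_graph p q l) sigma
  = \rank (kermx (infty_mx p.-1 m q e ((-1) ^+ odd p.-1 * e)
                           f ((-1) ^+ odd q.-1 * f))).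
Proof.
move=> p3 q3 l1; rewrite nullityE rank_kermx_gauge.
have nE : infty_order p q l = (m + q)%N by rewrite infty_orderE //; lia.
have leftE (i : 'I_p) : @infty_left p q l i = (0 + i)%N :> nat.
  exact: infty_leftE.
have rightE := @infty_rightE p q l p3 q3 l1.
have eE : e = (-1) ^+ gauge_l sigma p.-1 * (-1) ^+ sigma (nat_edge _ p.-1 0)
              * (-1) ^+ gauge_r sigma 0.
  rewrite /e /s_p negative_edges_cycle //.
  have psE := @path_signs_inherit _ _ _ sigma 0 p.-1 leftE.
  rewrite add0n in psE.
  rewrite [inherit _ _ (nat_edge _ _ _)](_ : _ = sigma (nat_edge _ p.-1 0)); last first.
    by rewrite /inherit (imset_nat_edge leftE) ?add0n 1?nat_edgeC; lia.
  rewrite -!exprD -signr_odd -[in RHS]signr_odd; congr (_ ^+ nat_of_bool _).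
  have ps0 : path_signs sigma 0 = 0%N by rewrite /path_signs big_ord0.
  rewrite /gauge_l /gauge_r psE ?ps0; lia.
have eE' : (-1) ^+ odd p.-1 * e = (-1) ^+ gauge_l sigma 0
    * (-1) ^+ sigma (nat_edge _ 0 p.-1) * (-1) ^+ gauge_r sigma p.-1.
  by rewrite gauge_chord // subn0 -eE.
have fE : f = (-1) ^+ gauge_l sigma (m + q).-1
    * (-1) ^+ sigma (nat_edge _ (m + q).-1 m) * (-1) ^+ gauge_r sigma m.
  rewrite /f /s_q negative_edges_cycle //.
  have mqE : (m + q.-1 = (m + q).-1)%N by lia.
  have psE := @path_signs_inherit _ _ _ sigma m q.-1 rightE.
  rewrite mqE in psE.
  rewrite [inherit _ _ (nat_edge _ _ _)](_ : _ = sigma (nat_edge _ (m + q).-1 m)); last first.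
    by rewrite /inherit (imset_nat_edge rightE) -/m ?addn0 ?mqE 1?nat_edgeC; lia.
  rewrite -!exprD -signr_odd -[in RHS]signr_odd; congr (_ ^+ nat_of_bool _).
  rewrite /gauge_l /gauge_r psE; lia.
have fE' : (-1) ^+ odd q.-1 * f = (-1) ^+ gauge_l sigma m
    * (-1) ^+ sigma (nat_edge _ m (m + q).-1) * (-1) ^+ gauge_r sigma (m + q).-1.
  by rewrite gauge_chord -?fE; [congr ((-1) ^+ odd _ * _)|]; lia.
(* With entries given by a function on natural numbers, the dimension [infty_order p q l] can be
   rewritten to [m + q]. *)
pose B (i j : nat) := skew_path F i j + chord 0 p.-1 e ((-1) ^+ odd p.-1 * e) i j
  + chord m (m + q).-1 f ((-1) ^+ odd q.-1 * f) i j.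
transitivity (\rank (kermx (\matrix_(i < infty_order p q l, j < infty_order p q l) B i j))); last by rewrite nE.
congr (\rank (kermx _)); apply/matrixP => i j; rewrite !mxE mem_infty // -/m.
rewrite /B /skew_path /chord /=.
have := ltn_ord i; have := ltn_ord j; rewrite [X in (_ < X)%N]nE.
rewrite [X in _ -> (_ < X)%N -> _]nE.
have m2 : (2 <= m)%N by lia.
have pm : (p.-1 <= m)%N by lia.
move: (nat_of_ord i) (nat_of_ord j) => {}i {}j lt_j lt_i.
have [jE|ji] := eqVneq j i.+1.
  rewrite {}jE {j} in lt_j *.
  have -> : (i.+2 == i)%N = false by lia.
  have -> : ((i == 0) && (i.+1 == p.-1))%N = false by lia.
  have -> : ((i == (m + q).-1) && (i.+1 == m))%N = false by lia.
  have -> : ((i == m) && (i.+1 == (m + q).-1))%N = false by lia.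
  by rewrite gauge_up andbF /= !mulr0 subr0 !addr0.
have [iE|ij] := eqVneq i j.+1.
  rewrite {}iE {i ji} in lt_i *.
  have -> : ((j.+1 == p.-1) && (j == 0))%N = false by lia.
  have -> : ((j.+1 == (m + q).-1) && (j == m))%N = false by lia.
  have -> : ((j.+1 == m) && (j == (m + q).-1))%N = false by lia.
  by rewrite gauge_down /= !mulr0 sub0r !addr0.
rewrite /= subrr add0r.
have [iE|i0] := eqVneq i 0%N.
  rewrite {}iE {i ji ij} in lt_i *.
  have -> : (0 == p.-1)%N = false by lia.
  have -> : (0 == m)%N = false by lia.
  have -> : (0 == (m + q).-1)%N = false by lia.
  rewrite eE' /= !andbF !mulr0 !addr0 add0r orbF.
  by case: eqVneq => [->|_]; rewrite /= ?mulr1 ?mulr0.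
rewrite /= mulr0 addr0.
have [/andP[/eqP iE /eqP jE]|_] := boolP ((i == m) && (j == (m + q).-1)).
  rewrite {}iE {}jE {i j lt_i lt_j ji ij i0}.
  have -> : ((m + q).-1 == 0)%N = false by lia.
  have -> : ((m + q).-1 == m)%N = false by lia.
  by rewrite fE' !andbF /= !mulr0 mulr1 !add0r.
rewrite [(j == m) && _]andbC.
have [/andP[/eqP iE /eqP jE]|_] := boolP ((i == (m + q).-1) && (j == m)).
  rewrite {}iE {}jE {i j lt_i lt_j ji ij i0}.
  have -> : (m == 0)%N = false by lia.
  have -> : ((m + q).-1 == p.-1)%N = false by lia.
  by rewrite fE /= !mulr0 mulr1 addr0 add0r.
rewrite /= !mulr0 !addr0 orbF andbC.
have [/andP[/eqP -> /eqP ->]|_] := boolP ((i == p.-1) && (j == 0))%N.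
  by rewrite eE mulr1.
by rewrite mulr0.
Qed.

(* Nullities as functions of parities *)
Local Close Scope ring_scope.

(** As [p.-1./2] is p/2 - 1 here, this is the classical criterion: the nullity is 2 exactly when the
    number of negative edges has the parity of p/2. *)
Lemma nullity_cycle_even (F : realFieldType) p (sigma : signing p) :
  3 <= p -> ~~ odd p ->
  nullity F (cycle_graph p) sigma
  = if odd (negative_edges (cycle_graph p) sigma + p.-1./2) then 2 else 0.
Proof.
move=> p3 pe; rewrite nullity_cycle // -[RHS]if_neg -(cycle_mx_even_nullity F _ p3 pe).
have -> : odd p.-1 by lia.
by rewrite expr1 mulN1r -signr_odd.
Qed.

(* The sign shift occurs because the scaling starts at vertex 0, not at the first
   vertex m = p + l - 2 of C_q. *)
Lemma nullity_infty_coords (F : realFieldType) p q l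
    (sigma : signing (infty_order p q l))
    (s_p := negative_edges (cycle_graph p) (inherit (@infty_left p q l) sigma))
    (s_q := negative_edges (cycle_graph q) (inherit (@infty_right p q l) sigma)) :
  3 <= p -> 3 <= q -> 1 <= l ->
  nullity F (infty_graph p q l) sigma
  = size (infty_coords (~~ odd p) (~~ odd l) (~~ odd q)
            (~~ odd (s_p + p.-1./2))
            (~~ odd (s_q + q.-1./2 + (odd q && (odd p != odd l))))).
Proof.
move=> p3 q3 l1; rewrite nullity_infty //.
rewrite -(signr_odd _ (_ + p.-1./2).+1) -(signr_odd _ (_ + uphalf _).+1).
rewrite infty_mx_nullity; try lia.
congr (size (infty_coords _ _ _ _ _)); lia.
Qed.

Theorem theorem4p1 (R : realFieldType) (p q l : nat)
    (hp : 3 <= p) (hq : 3 <= q) (hl : 1 <= l)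
    (sigma : signing (infty_order p q l)) :
  let eta := nullity R (infty_graph p q l) sigma in
  let sigma_p := inherit (@infty_left p q l) sigma in
  let sigma_q := inherit (@infty_right p q l) sigma in
  let eta_p := nullity R (cycle_graph p) sigma_p in
  let eta_q := nullity R (cycle_graph q) sigma_q in
  let s_p := negative_edges (cycle_graph p) sigma_p in
  let s_q := negative_edges (cycle_graph q) sigma_q in
  let d : int := (s_p%:Z - s_q%:Z + ((q%:Z - p%:Z) %/ 2)%Z)%R in
  [/\ (* p and q both odd *)
      odd p -> odd q ->
      [/\ ~~ odd l -> eta = 0,
          odd l -> (d = 0 %[mod 2])%Z -> eta = 0,
          l = 1 -> (d = 1 %[mod 2])%Z -> eta = 1
        & 3 <= l -> odd l -> (d = 1 %[mod 2])%Z -> 1 <= eta],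
      (* p and q of different parities; the even one is p, resp. q *)
      (~~ odd p -> odd q ->
       (eta_p = 0 -> eta = 0) /\ (eta_p = 2 -> eta = 1)) /\
      (odd p -> ~~ odd q ->
       (eta_q = 0 -> eta = 0) /\ (eta_q = 2 -> eta = 1))
    & (* p and q both even *)
      ~~ odd p -> ~~ odd q ->
      [/\ odd l -> eta_p = 2 -> eta_q = 2 -> eta = 3,
          odd l -> eta_p * eta_q = 0 -> eta = 1,
          ~~ odd l -> eta_p = 2 \/ eta_q = 2 -> eta = 2
        & ~~ odd l -> eta_p = 0 -> eta_q = 0 -> eta = 0]].
Proof.
move=> eta sigma_p sigma_q eta_p eta_q s_p s_q d.
(* For an even cycle the bit says that its nullity is 2; for two odd cycles and odd [l] only the
   comparison of the bits matters. *)
pose b := odd (s_p + p.-1./2); pose b' := odd (s_q + q.-1./2).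
have etaE : eta = _ := nullity_infty_coords R sigma hp hq hl.
rewrite -/sigma_p -/sigma_q -/s_p -/s_q -/b in etaE.
have eta_pE : ~~ odd p -> eta_p = if b then 2 else 0 by exact: nullity_cycle_even.
have eta_qE : ~~ odd q -> eta_q = if b' then 2 else 0 by exact: nullity_cycle_even.
split.
- move=> op oq; rewrite op oq /= in etaE.
  case ol : (odd l) in etaE *; rewrite /= ?addn0 -/b' in etaE.
    (* For odd p and q, (q - p)/2 is the difference of the halves [q.-1./2] and [p.-1./2], and signs
       are irrelevant modulo 2. *)
    have dE : (d %% 2)%Z = Posz (b != b').
      by rewrite /d /b /b'; lia.
    split=> //; first by move=> _ d0; rewrite etaE; move: dE; rewrite d0; case: (b) (b') => [] [].
      by move=> _ d1; rewrite etaE; move: dE; rewrite d1; case: (b) (b') => [] [].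
    by move=> _ _ d1; rewrite etaE; move: dE; rewrite d1; case: (b) (b') => [] [].
  by split=> // l1; move: ol; rewrite l1.
- split=> op oq; rewrite ?(negPf op) ?(negPf oq) ?op ?oq /= ?addn0 -/b' in etaE.
    by rewrite eta_pE // etaE; case: (b).
  by rewrite eta_qE // etaE; case: (b').
move=> op oq; rewrite (negPf op) (negPf oq) /= addn0 -/b' in etaE.
rewrite eta_pE // eta_qE // etaE.
by case: (odd l); case: (b); case: (b'); split=> // ? [].
Qed.
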